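(* Let $N\in\mathbb N$, $N\ge 2$, and $q=e^{i\gamma}$, where $\frac{\pi}{N+1}\le\gamma<\frac{\pi}{N}$. Let $n\ge 1$ and let $T\in\mathrm{Mat}(n^2,\mathbb C)$ be a Hermitian matrix, $T\ne 0$, satisfying $$T^2=(q+q^{-1})\,T,\qquad (T\otimes I)(I\otimes T)(T\otimes I)-(I\otimes T)(T\otimes I)(I\otimes T)=T\otimes I-I\otimes T,$$ where $I\in\mathrm{Mat}(n,\mathbb C)$ is the identity matrix and $\otimes$ is the Kronecker product. Let $\tau: H_N(q)\to\mathrm{Mat}(n^N,\mathbb C)$ be the corresponding representation, $\tau(\mathsf T_k)=I^{\otimes(k-1)}\otimes T\otimes I^{\otimes(N-k-1)}$ for $k=1,\ldots,N-1$. Then $\tau(\mathsf P_N)=0$.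
   Context: Here $q\in\mathbb C$ is a fixed number with $|q|=1$, and $H_N(q)$ is the unital associative complex algebra with generators $\mathsf R_1,\ldots,\mathsf R_{N-1}$ and relations $\mathsf R_k^2 = \mathsf 1 + (q-q^{-1})\mathsf R_k$; $\mathsf R_k \mathsf R_m \mathsf R_k = \mathsf R_m \mathsf R_k \mathsf R_m$ for $|k-m|=1$; $\mathsf R_k \mathsf R_m = \mathsf R_m \mathsf R_k$ for $|k-m|\ge 2$. With $\mathsf T_k=q^{-1}\cdot\mathsf 1+\mathsf R_k$ these relations are equivalent to $\mathsf T_k^2=(q+q^{-1})\mathsf T_k$; $\mathsf T_k\mathsf T_m\mathsf T_k-\mathsf T_m\mathsf T_k\mathsf T_m=\mathsf T_k-\mathsf T_m$ for $|k-m|=1$; $\mathsf T_k\mathsf T_m=\mathsf T_m\mathsf T_k$ for $|k-m|\ge2$. For $k\in\mathbb Z$, $[k] = \frac{q^k-q^{-k}}{q-q^{-1}}=\frac{\sin(k\gamma)}{\sin\gamma}$. The $q$-antisymmetrizers $\mathsf P_1,\ldots,\mathsf P_N\in H_N(q)$ are defined recursively by $\mathsf P_1=\mathsf 1$ and $\mathsf P_{k+1}=\mathsf P_k-\frac{[k]}{[k+1]}\,\mathsf P_k\mathsf T_k\mathsf P_k$ for $k=1,\ldots,N-1$ (the denominators $[2],\ldots,[N]$ are nonzero for the given range of $\gamma$). *)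

(* Defs.v *)
From HB Require Import structures.
From mathcomp Require Import all_boot all_order all_algebra.
From mathcomp Require Import boolp reals trigo.
From mathcomp Require Import complex.
From mathcomp Require mxtens monalg.
(* Some notations of these two files clash with those imported above. *)
Import -(notations) mxtens.
Import -(notations) monalg.

Set Implicit Arguments.
Unset Strict Implicit.
Unset Printing Implicit Defensive.

Import GRing.Theory Num.Theory.
Local Open Scope ring_scope.
Local Open Scope quotient_scope.

Notation "A *t B" := (tensmx A B)
  (at level 40, left associativity, format "A  *t  B") : ring_scope.

Section FreeAlgebra.
Variables (K : fieldType) (I : choiceType).

(* Linear combinations of words over [I], multiplied by concatenation: the
   free unital associative K-algebra on [I]. *)
Definition free_alg : Type := malg (fmonom I) K.
HB.instance Definition _ := GRing.Lalgebra.on free_alg.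

Definition free_gen (i : I) : free_alg := mkmalgU (fmu i) 1.

Lemma free_algAr (c : K) (x y : free_alg) : c *: (x * y) = x * (c *: y).
Proof.
have scaleE (z : free_alg) : c *: z = malgC c * z by rewrite mul_malgC.
suff comm_c : malgC c * x = x * malgC c.
  rewrite (scaleE y) (scaleE (x * y)).
  transitivity (malgC c * x * y : free_alg); first exact: mulrA.
  transitivity (x * malgC c * y : free_alg); last exact/esym/mulrA.
  exact: (congr1 (fun z : free_alg => z * y) comm_c).
rewrite mul_malgC malgM_def /malgC fgmulgU malgZ_def /fgscale.
by apply: eq_bigr => k _; rewrite mulm1 mulrC.
Qed.

End FreeAlgebra.

Inductive ideal_gen (A : pzRingType) (S : A -> Prop) : A -> Prop :=
| ideal_gen_in x : S x -> ideal_gen S x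
| ideal_gen0 : ideal_gen S 0
| ideal_genB x y : ideal_gen S x -> ideal_gen S y -> ideal_gen S (x - y)
| ideal_genMl a x : ideal_gen S x -> ideal_gen S (a * x)
| ideal_genMr a x : ideal_gen S x -> ideal_gen S (x * a).

Section Hecke.
Variables (K : fieldType) (N : nat) (q : K).

(* Indices are shifted: [i : 'I_N.-1] labels the generator number i + 1. *)
Local Notation F := (free_alg K 'I_N.-1).
Local Notation r := (@free_gen K 'I_N.-1).

(* [hecke_rel (x - y)] encodes the defining relation x = y. *)
Variant hecke_rel : F -> Prop :=
| hecke_quad k : hecke_rel (r k * r k - (1 + (q - q^-1) *: r k))
| hecke_braid (k m : 'I_N.-1) of k.+1 = m \/ m.+1 = k :
    hecke_rel (r k * r m * r k - r m * r k * r m)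
| hecke_comm (k m : 'I_N.-1) of (k.+2 <= m)%N \/ (m.+2 <= k)%N :
    hecke_rel (r k * r m - r m * r k).

Definition hecke_ideal : {pred F} := fun x => `[< ideal_gen hecke_rel x >].

Lemma hecke_idealP x : reflect (ideal_gen hecke_rel x) (x \in hecke_ideal).
Proof. exact: asboolP. Qed.

Lemma hecke_ideal_zmod : zmod_closed hecke_ideal.
Proof.
split; first by apply/hecke_idealP; exact: ideal_gen0.
move=> x y /hecke_idealP hx /hecke_idealP hy.
by apply/hecke_idealP; exact: ideal_genB.
Qed.
HB.instance Definition _ := GRing.isZmodClosed.Build F hecke_ideal
  hecke_ideal_zmod.

Definition hecke : Type := Quotient.quot hecke_ideal.
HB.instance Definition _ := GRing.Zmodule.on hecke.
HB.instance Definition _ := EqQuotient.on hecke.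

Definition hecke_pi (x : F) : hecke := \pi_(Quotient.quot hecke_ideal) x.

Lemma hecke_pi_eq x y : hecke_pi x = hecke_pi y <-> x - y \in hecke_ideal.
Proof.
by split=> [/eqP|h]; [|apply/eqP]; rewrite /hecke_pi -Quotient.idealrBE.
Qed.

Lemma hecke_piD x y : hecke_pi (x + y) = hecke_pi x + hecke_pi y.
Proof. by rewrite /hecke_pi !piE. Qed.

Lemma hecke_repr x : exists y, x = hecke_pi y.
Proof. by exists (repr x); rewrite /hecke_pi reprK. Qed.

Definition hecke_mul (x y : hecke) : hecke := hecke_pi (repr x * repr y).
Definition hecke_scale (c : K) (x : hecke) : hecke := hecke_pi (c *: repr x).

Lemma hecke_repr_pi x : repr (hecke_pi x) - x \in hecke_ideal.
Proof. by apply/hecke_pi_eq; rewrite {1}/hecke_pi reprK. Qed.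

Lemma hecke_piM x y : hecke_pi (x * y) = hecke_mul (hecke_pi x) (hecke_pi y).
Proof.
apply/esym/hecke_pi_eq.
set x' := repr _; set y' := repr _.
have -> : x' * y' - x * y = (x' - x) * y' + x * (y' - y).
  by rewrite mulrBl mulrBr addrA addrNK.
apply: rpredD; apply/hecke_idealP.
- by apply/ideal_genMr/hecke_idealP; exact: hecke_repr_pi.
- by apply/ideal_genMl/hecke_idealP; exact: hecke_repr_pi.
Qed.

Lemma hecke_piZ c x : hecke_pi (c *: x) = hecke_scale c (hecke_pi x).
Proof.
apply/esym/hecke_pi_eq; rewrite -scalerBr -[_ - x]mul1r scalerAl.
by apply/hecke_idealP/ideal_genMl/hecke_idealP; exact: hecke_repr_pi.
Qed.

(* The algebra is nontrivial: each generator may be sent to q (to 1 if q = 0)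
   in K. *)
Definition hecke_char_val : K := if q == 0 then 1 else q.

Definition hecke_char_mon (m : fmonom 'I_N.-1) : K := hecke_char_val ^+ size m.

Lemma hecke_char_mon_mmorphism : mmorphism hecke_char_mon.
Proof.
by split=> [x y|]; rewrite /hecke_char_mon ?fmM ?fm1 // size_cat exprD.
Qed.
HB.instance Definition _ := isMultiplicative.Build (fmonom 'I_N.-1) K
  hecke_char_mon hecke_char_mon_mmorphism.

Definition hecke_char : F -> K := mmap (@idfun K) hecke_char_mon.
HB.instance Definition _ := GRing.RMorphism.on hecke_char.

Lemma hecke_char_gen i : hecke_char (r i) = hecke_char_val.
Proof. by rewrite /hecke_char mmapU mul1r /hecke_char_mon fmU expr1. Qed.

Lemma hecke_charZ c x : hecke_char (c *: x) = c * hecke_char x.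
Proof. exact: mmapZ. Qed.

Lemma hecke_charB x y : hecke_char (x - y) = hecke_char x - hecke_char y.
Proof. exact: rmorphB. Qed.

Lemma hecke_charD x y : hecke_char (x + y) = hecke_char x + hecke_char y.
Proof. exact: rmorphD. Qed.

Lemma hecke_charM x y : hecke_char (x * y) = hecke_char x * hecke_char y.
Proof. exact: rmorphM. Qed.

Lemma hecke_char1 : hecke_char 1 = 1.
Proof. exact: rmorph1. Qed.

Lemma hecke_char_ideal x : ideal_gen hecke_rel x -> hecke_char x = 0.
Proof.
have char2 k m : hecke_char (r k * r m) = hecke_char_val * hecke_char_val.
  by rewrite (hecke_charM (r k)) !hecke_char_gen.
have char3 k m l : hecke_char (r k * r m * r l) = hecke_char_val ^+ 3.
  by rewrite (hecke_charM (_ * _)) char2 hecke_char_gen -expr2 -exprSr.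
elim=> {x} [x|||a x _ h|a x _ h].
- case=> [k|k m _|k m _]; rewrite hecke_charB.
  + rewrite hecke_charD char2 hecke_charZ hecke_char1 hecke_char_gen.
    rewrite /hecke_char_val; case: eqP => [->|/eqP q0].
      by rewrite invr0 subrr mul0r addr0 mulr1 subrr.
    by rewrite mulrBl mulVf // [1 + _]addrC addrNK subrr.
  + apply/eqP; rewrite subr_eq0; apply/eqP; exact: etrans (char3 k m k) (esym (char3 m k m)).
  + apply/eqP; rewrite subr_eq0; apply/eqP; exact: etrans (char2 k m) (esym (char2 m k)).
- by rewrite -(subrr (1 : F)) hecke_charB subrr.
- by move=> x y _ hx _ hy; rewrite hecke_charB hx hy subrr.
- by rewrite hecke_charM h mulr0.
- by rewrite hecke_charM h mul0r.
Qed.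

Lemma hecke_mulA : associative hecke_mul.
Proof.
move=> x y z; case: (hecke_repr x) (hecke_repr y) (hecke_repr z).
by move=> a -> [b ->] [c ->]; rewrite -!hecke_piM mulrA.
Qed.

Lemma hecke_mul1x : left_id (hecke_pi 1) hecke_mul.
Proof. by move=> x; case: (hecke_repr x) => a ->; rewrite -hecke_piM mul1r. Qed.

Lemma hecke_mulx1 : right_id (hecke_pi 1) hecke_mul.
Proof. by move=> x; case: (hecke_repr x) => a ->; rewrite -hecke_piM mulr1. Qed.

Lemma hecke_mulDl : left_distributive hecke_mul +%R.
Proof.
move=> x y z; case: (hecke_repr x) (hecke_repr y) (hecke_repr z).
by move=> a -> [b ->] [c ->]; rewrite -hecke_piD -!hecke_piM -hecke_piD mulrDl.
Qed.

Lemma hecke_mulDr : right_distributive hecke_mul +%R.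
Proof.
move=> x y z; case: (hecke_repr x) (hecke_repr y) (hecke_repr z).
by move=> a -> [b ->] [c ->]; rewrite -hecke_piD -!hecke_piM -hecke_piD mulrDr.
Qed.

Lemma hecke_1neq0 : hecke_pi 1 != 0.
Proof.
have -> : 0 = hecke_pi 0 by rewrite /hecke_pi !piE.
apply/eqP => /hecke_pi_eq; rewrite subr0 => /hecke_idealP/hecke_char_ideal/eqP.
by rewrite hecke_char1 oner_eq0.
Qed.

HB.instance Definition _ := GRing.Zmodule_isNzRing.Build hecke
  hecke_mulA hecke_mul1x hecke_mulx1 hecke_mulDl hecke_mulDr hecke_1neq0.

Lemma hecke_scaleA a b x :
  hecke_scale a (hecke_scale b x) = hecke_scale (a * b) x.
Proof. by case: (hecke_repr x) => y ->; rewrite -!hecke_piZ scalerA. Qed.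

Lemma hecke_scale1 : left_id 1 hecke_scale.
Proof. by move=> x; case: (hecke_repr x) => y ->; rewrite -hecke_piZ scale1r. Qed.

Lemma hecke_scaleDr : right_distributive hecke_scale +%R.
Proof.
move=> c x y; case: (hecke_repr x) (hecke_repr y) => a -> [b ->].
by rewrite -hecke_piD -!hecke_piZ -hecke_piD scalerDr.
Qed.

Lemma hecke_scaleDl x : {morph hecke_scale^~ x : a b / a + b}.
Proof.
by move=> a b; case: (hecke_repr x) => y ->; rewrite -!hecke_piZ -hecke_piD scalerDl.
Qed.

HB.instance Definition _ := GRing.Zmodule_isLmodule.Build K hecke
  hecke_scaleA hecke_scale1 hecke_scaleDr hecke_scaleDl.

Lemma hecke_scaleAl c (x y : hecke) : c *: (x * y) = (c *: x) * y.
Proof.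
case: (hecke_repr x) (hecke_repr y) => a -> [b ->].
by rewrite /GRing.mul /GRing.scale /= -hecke_piM -!hecke_piZ -hecke_piM scalerAl.
Qed.

HB.instance Definition _ := GRing.Lmodule_isLalgebra.Build K hecke hecke_scaleAl.

Lemma hecke_scaleAr c (x y : hecke) : c *: (x * y) = x * (c *: y).
Proof.
case: (hecke_repr x) (hecke_repr y) => a -> [b ->].
by rewrite /GRing.mul /GRing.scale /= -hecke_piM -!hecke_piZ -hecke_piM free_algAr.
Qed.

HB.instance Definition _ := GRing.Lalgebra_isAlgebra.Build K hecke hecke_scaleAr.

Definition heckeR (k : 'I_N.-1) : hecke := hecke_pi (r k).
Definition heckeT (k : 'I_N.-1) : hecke := q^-1 *: 1 + heckeR k.

Definition qnum (k : int) : K := (q ^ k - q ^ (- k)) / (q - q^-1).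

(* [qasym k] is the k-th q-antisymmetrizer for 1 <= k <= N; the values for
   k = 0 and k > N are irrelevant, and [insub j] succeeds when j.+2 <= N. It then
   yields the label of the generator number j + 1. *)
Fixpoint qasym (k : nat) : hecke :=
  if k is k1.+1 then
    if k1 is j.+1 then
      let P := qasym k1 in
      let T := oapp heckeT 0 (insub j : option 'I_N.-1) in
      P - (qnum k1 / qnum k) *: (P * T * P)
    else 1
  else 1.

End Hecke.

Definition expi (R : realType) (t : R) : R[i] := Complex (cos t) (sin t).

Section TensorLegs.
Variables (R : comPzRingType) (n : nat).
Implicit Type T : 'M[R]_(n ^ 2).

Lemma tens3_dim : (n * n ^ 2 = n ^ 2 * n)%N.
Proof. exact: mulnC. Qed.

(* The cast preserves the values of the indices, so [legs12 T] and [legs23 T]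
   use the same (lexicographic) ordering of the basis. *)
Definition legs12 T : 'M[R]_(n ^ 2 * n) := T *t (1%:M : 'M_n).
Definition legs23 T : 'M[R]_(n ^ 2 * n) :=
  castmx (tens3_dim, tens3_dim) ((1%:M : 'M_n) *t T).

Lemma tensN_dim N (k : 'I_N.-1) :
  (n ^ k * n ^ 2 * n ^ (N - k.+2) = n ^ N)%N.
Proof.
rewrite -!expnD addn2 subnKC //.
by case: N k => [|[|N]] [k] //=; rewrite ltnS.
Qed.

(* I^{(x) k} (x) T (x) I^{(x) (N - k - 2)}, with k counted from 0. *)
Definition legsN N T (k : 'I_N.-1) : 'M[R]_(n ^ N) :=
  castmx (tensN_dim k, tensN_dim k)
    (ntensmx (1%:M : 'M_n) k *t T *t ntensmx (1%:M : 'M_n) (N - k.+2)).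

End TensorLegs.

(* Main.v *)
Require Import Defs.
From HB Require Import structures.
From mathcomp Require Import all_boot all_order all_algebra.
From mathcomp Require Import boolp reals trigo.
From mathcomp Require Import complex.
From mathcomp Require mxtens.
From mathcomp Require Import zify ring.
Import -(notations) mxtens.

Set Implicit Arguments.
Unset Strict Implicit.
Unset Printing Implicit Defensive.

Import Order.TTheory GRing.Theory Num.Theory.
Local Open Scope ring_scope.

(* Let P be the N-th antisymmetrizer and let all operators act on the tensor
   power with N + 2 legs. In the Hecke algebra
     (P T_N P)^2 = ([N+1] / [N]) P T_N P,
   where P and T_N are Hermitian, T_N^2 = [2] T_N with [2] > 0 and, in the given
   range of gamma, [N+1] <= 0 < [N]; positivity of the trace form then gives
   T_N P = 0. The same argument applied to legs 2, ..., N + 1 gives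
   T_(N+1) P' = 0 for the shifted antisymmetrizer P'. Since T_2, ..., T_N all
   kill P, one has P' P = P, hence T_(N+1) P = 0. But T_(N+1) acts on the last
   two legs only and P on the first N, so this reads tau(P) (x) T = 0. *)

(** * Algebra of the antisymmetrizers, with [a] standing for the quantum integers *)

Section Antisymmetrizers.
Variables (K : fieldType) (d : nat) (a : nat -> K).
Implicit Type t : nat -> 'M[K]_d.

(* The antisymmetrizer called P_(k+1) in the informal text is [asym t k], and
   [t i] plays the role of T_(i+1). *)
Fixpoint asym t k : 'M[K]_d :=
  if k is j.+1 then
    asym t j - (a j.+1 / a j.+2) *: (asym t j *m t j *m asym t j)
  else 1%:M.

(** The relations of the Hecke algebra in the generators T_k, with [a 2] in the place of q +
    q^-1. *)
Definition hecke_family (m : nat) t :=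
  [/\ forall i, (i < m)%N -> t i *m t i = a 2 *: t i,
      forall i, (i.+1 < m)%N ->
        t i *m t i.+1 *m t i - t i.+1 *m t i *m t i.+1 = t i - t i.+1
    & forall i j, (i.+1 < j)%N -> (j < m)%N -> t i *m t j = t j *m t i].

Lemma hecke_family_shift m t :
  hecke_family m.+1 t -> hecke_family m (fun i => t i.+1).
Proof.
case=> h1 h2 h3; split=> [i im|i im|i j ij jm]; first exact: h1.
- exact: h2.
- exact: h3.
Qed.

Lemma hecke_family_leq m m' t :
  (m' <= m)%N -> hecke_family m t -> hecke_family m' t.
Proof.
move=> le_m [h1 h2 h3]; split=> [i im|i im|i j ij jm].
- by apply: h1; apply: leq_trans le_m.
- by apply: h2; apply: leq_trans le_m.
- by apply: h3 => //; apply: leq_trans le_m.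
Qed.

(** [asym t k] is built from the [t i] with [i < k], all at distance at least 2 from [t j]. *)
Lemma asym_comm m t k j : hecke_family m t ->
  (k < j)%N -> (j < m)%N -> t j *m asym t k = asym t k *m t j.
Proof.
case=> _ _ comm_t; elim: k => [|k IHk] kj jm /=; first by rewrite mul1mx mulmx1.
have IH := IHk (ltnW kj) jm.
rewrite mulmxBr mulmxBl -scalemxAr -scalemxAl IH; congr (_ - _ *: _).
by rewrite !mulmxA IH -(mulmxA _ (t j)) -comm_t // -!mulmxA IH.
Qed.

Lemma asym_absorb t k (A : 'M[K]_d) :
  (forall j, (j < k)%N -> t j *m A = 0) -> asym t k *m A = A.
Proof.
elim: k => [|k IHk] tA /=; first by rewrite mul1mx.
have IH : asym t k *m A = A by apply: IHk => j jk; apply: tA; apply: ltnW.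
by rewrite mulmxBl -scalemxAl -!mulmxA IH tA // mulmx0 scaler0 subr0.
Qed.

Hypotheses (a1 : a 1 = 1) (a_rec : forall k, a k.+2 = a 2 * a k.+1 - a k).

(** One induction proves all three claims: the third for [k] makes [t k] kill the next
    antisymmetrizer, and this killing with the braid relation gives the third for [k.+1]. The
    numerator [a k.+2] may vanish, as [N+1] does for gamma = pi/(N+1). *)
Lemma asym_spec m t k : hecke_family m t -> (k < m)%N ->
    (forall j, (0 < j <= k.+1)%N -> a j != 0) ->
  [/\ asym t k *m asym t k = asym t k,
      forall j, (j < k)%N -> t j *m asym t k = 0
    & t k *m asym t k *m t k *m asym t k
        = (a k.+2 / a k.+1) *: (t k *m asym t k)].
Proof.
move=> ht; have [quad braid _] := ht.
elim: k => [|k IHk] km a_neq0.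
  by rewrite /= !mulmx1 a1 divr1 quad //; split.
have [| |idem kill TPTP] := IHk; [exact: ltnW| |].
  by move=> j /andP[j0 jk]; apply: a_neq0; rewrite j0 leqW.
have a1n0 : a k.+1 != 0 by rewrite a_neq0 //= leqW.
have a2n0 : a k.+2 != 0 by rewrite a_neq0 /=.
set c := a k.+1 / a k.+2.
have cV : c * (a k.+2 / a k.+1) = 1 by rewrite /c mulrA mulfVK // divff.
have asymS : asym t k.+1
    = asym t k - c *: (asym t k *m t k *m asym t k) by [].
set p := asym t k in idem kill TPTP asymS *.
set p' := asym t k.+1 in asymS *; clearbody p'.
have pp' : p *m p' = p'.
  by rewrite asymS mulmxBr -scalemxAr !mulmxA !idem.
have kill' j : (j < k.+1)%N -> t j *m p' = 0.
  rewrite ltnS leq_eqVlt => /orP[/eqP->|jk].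
    rewrite asymS mulmxBr -scalemxAr !mulmxA TPTP scalerA cV scale1r.
    exact: subrr.
  by rewrite asymS mulmxBr -scalemxAr !mulmxA kill // !mul0mx scaler0 subr0.
have comm : t k.+1 *m p = p *m t k.+1 by apply: (asym_comm ht).
(* Multiply the braid relation by [p'] on the right: the two terms ending in [t k] vanish. *)
have TSTp : t k.+1 *m t k *m t k.+1 *m p' = t k.+1 *m p'.
  have /(congr1 (fun A => A *m p')) := braid _ km.
  rewrite !mulmxBl -(mulmxA _ (t k) p') kill' // mulmx0 !sub0r.
  exact: oppr_inj.
split=> //.
  rewrite {1}asymS mulmxBl pp' -scalemxAl -!mulmxA pp' kill' //.
  by rewrite mulmx0 scaler0 subr0.
(* Expanding the inner [p'] leaves the coefficient [a 2 - c], which [a_rec] turns into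
   [a k.+3 / a k.+2]. *)
rewrite {1}asymS mulmxBr !mulmxBl -scalemxAr -!scalemxAl.
have -> : t k.+1 *m p *m t k.+1 *m p' = a 2 *: (t k.+1 *m p').
  rewrite -(mulmxA (t k.+1) p) -comm mulmxA quad // -!mulmxA pp'.
  by rewrite scalemxAl.
have -> : t k.+1 *m (p *m t k *m p) *m t k.+1 *m p' = t k.+1 *m p'.
  rewrite !mulmxA comm -!mulmxA (mulmxA p _ p') -comm -!mulmxA pp'.
  rewrite (mulmxA (t k)) (mulmxA (t k.+1)) (mulmxA (t k.+1)) TSTp.
  by rewrite mulmxA -comm -mulmxA pp'.
by rewrite -scalerBl (a_rec k.+1) mulrBl mulfK.
Qed.

End Antisymmetrizers.

(** * Positivity of the trace form and the resulting vanishing *)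

Section Adjoint.
Variable C : numClosedFieldType.

Definition adjmx m n (A : 'M[C]_(m, n)) : 'M[C]_(n, m) := map_mx Num.conj A^T.

Lemma adjmxM m n p (A : 'M[C]_(m, n)) (B : 'M[C]_(n, p)) :
  adjmx (A *m B) = adjmx B *m adjmx A.
Proof. by rewrite /adjmx trmx_mul map_mxM. Qed.

Lemma adjmxB m n (A B : 'M[C]_(m, n)) : adjmx (A - B) = adjmx A - adjmx B.
Proof. by apply/matrixP=> i j; rewrite !mxE rmorphB. Qed.

Lemma adjmxZ m n c (A : 'M[C]_(m, n)) : adjmx (c *: A) = Num.conj c *: adjmx A.
Proof. by apply/matrixP=> i j; rewrite !mxE rmorphM. Qed.

Lemma adjmx1 n : adjmx (1%:M : 'M[C]_n) = 1%:M.
Proof. by rewrite /adjmx trmx1 map_mx1. Qed.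

Lemma trace_adjmxE m n (A : 'M[C]_(m, n)) :
  \tr (adjmx A *m A) = \sum_i \sum_j `|A j i| ^+ 2.
Proof.
apply: eq_bigr => i _; rewrite mxE; apply: eq_bigr => j _.
by rewrite !mxE normCKC.
Qed.

Lemma trace_adjmx_ge0 m n (A : 'M[C]_(m, n)) : 0 <= \tr (adjmx A *m A).
Proof.
by rewrite trace_adjmxE; do 2![apply: sumr_ge0 => ? _]; apply: exprn_ge0.
Qed.

Lemma trace_adjmx_eq0 m n (A : 'M[C]_(m, n)) :
  \tr (adjmx A *m A) <= 0 -> A = 0.
Proof.
move=> tr_le0; have : \tr (adjmx A *m A) == 0.
  by rewrite eq_le tr_le0 trace_adjmx_ge0.
rewrite trace_adjmxE psumr_eq0 => [/allP A0|i _]; last first.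
  by apply: sumr_ge0 => ? _; apply: exprn_ge0.
apply/matrixP=> j i; have := A0 i (mem_index_enum i).
rewrite psumr_eq0 => [/allP A0i|? _]; last exact: exprn_ge0.
have := A0i j (mem_index_enum j).
by rewrite mxE expf_eq0 normr_eq0 => /eqP.
Qed.

Lemma adjmx_mul_eq0 m n (A : 'M[C]_(m, n)) : adjmx A *m A = 0 -> A = 0.
Proof. by move=> AA0; apply: trace_adjmx_eq0; rewrite AA0 mxtrace0. Qed.

Section Vanishing.
Variables (d : nat) (a : nat -> C).
Implicit Type t : nat -> 'M[C]_d.

(** The coefficients are real and each product [P t P] is a palindrome. *)
Lemma asym_adj m t k : (forall j, Num.conj (a j) = a j) ->
  (forall i, (i < m)%N -> adjmx (t i) = t i) -> (k <= m)%N ->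
  adjmx (asym a t k) = asym a t k.
Proof.
move=> a_real t_adj; elim: k => [|k IHk] km /=; first exact: adjmx1.
have IH := IHk (ltnW km).
by rewrite adjmxB adjmxZ !adjmxM IH t_adj // rmorphM fmorphV /= !a_real mulmxA.
Qed.

Hypotheses (a1 : a 1 = 1) (a_rec : forall k, a k.+2 = a 2 * a k.+1 - a k).
Hypothesis a_real : forall j, Num.conj (a j) = a j.

(* With [P = asym a t m] and [X = P t_m P = (t_m P)^* (t_m P) / a 2], one has
   [X ^ 2 = (a m.+2 / a m.+1) X]: the trace of the left-hand side is
   nonnegative and the trace of the right-hand side is nonpositive. *)
Lemma next_mul_asym_eq0 m t : hecke_family a m.+1 t ->
    (forall i, (i < m.+1)%N -> adjmx (t i) = t i) ->
    (forall j, (0 < j <= m.+1)%N -> a j != 0) ->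
    0 < a 2 -> a m.+2 / a m.+1 <= 0 ->
  t m *m asym a t m = 0.
Proof.
move=> ht t_adj a_neq0 a2_gt0 ratio_le0.
have [quad _ _] := ht.
have [idem _ TPTP] := asym_spec a1 a_rec ht (ltnSn m) a_neq0.
have P_adj := asym_adj a_real t_adj (leqnSn m).
set P := asym a t m in idem TPTP P_adj *.
have YY : adjmx (t m *m P) *m (t m *m P) = a 2 *: (P *m t m *m P).
  rewrite adjmxM t_adj // P_adj -mulmxA (mulmxA (t m)) quad //.
  by rewrite -scalemxAl -scalemxAr mulmxA.
set X := P *m t m *m P in YY *.
have X_adj : adjmx X = X by rewrite !adjmxM t_adj // P_adj mulmxA.
have trX_ge0 : 0 <= \tr X.
  by rewrite -(pmulr_rge0 _ a2_gt0) -mxtraceZ -YY trace_adjmx_ge0.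
have XX : adjmx X *m X = (a m.+2 / a m.+1) *: X.
  by rewrite X_adj /X -!mulmxA (mulmxA P P) idem scalemxAr -TPTP -!mulmxA.
have X0 : X = 0.
  by apply: trace_adjmx_eq0; rewrite XX mxtraceZ mulr_le0_ge0.
by apply: adjmx_mul_eq0; rewrite YY X0 scaler0.
Qed.

Lemma last_mul_asym_eq0 m t : hecke_family a m.+2 t ->
    (forall i, (i < m.+2)%N -> adjmx (t i) = t i) ->
    (forall j, (0 < j <= m.+1)%N -> a j != 0) ->
    0 < a 2 -> a m.+2 / a m.+1 <= 0 ->
  t m.+1 *m asym a t m = 0.
Proof.
move=> ht t_adj a_neq0 a2_gt0 ratio_le0.
have ht' := hecke_family_leq (leqnSn _) ht.
have [_ kill _] := asym_spec a1 a_rec ht' (ltnSn m) a_neq0.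
have shift0 := @next_mul_asym_eq0 m _ (hecke_family_shift ht)
  (fun i im => t_adj i.+1 im) a_neq0 a2_gt0 ratio_le0.
have <- : asym a (fun i => t i.+1) m *m asym a t m = asym a t m; last first.
  by rewrite mulmxA shift0 mul0mx.
apply: asym_absorb => j jm.
(* For [j.+1 < m] the killing is algebraic; for [j.+1 = m] it comes from positivity on the unshifted
   family. *)
have [jm'|mj] := ltnP j.+1 m; first exact: kill.
have -> : j.+1 = m by apply/eqP; rewrite eqn_leq jm mj.
by apply: next_mul_asym_eq0 => // i im; apply: t_adj; apply: ltnW.
Qed.

End Vanishing.
End Adjoint.

(** * Tensor products up to casts of the matrix size *)

Section TensorCasts.
Variable R : comPzRingType.

(* Square matrices of all sizes: equality of dependent pairs makes the tensor
   product strictly associative and casts invisible. *)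
Definition sqmx n (A : 'M[R]_n) : {n : nat & 'M[R]_n} := Tagged _ A.

Lemma sqmx_cast m n (e : m = n) (A : 'M[R]_m) : sqmx (castmx (e, e) A) = sqmx A.
Proof. by case: n / e; rewrite castmx_id. Qed.

(** Transports a property from [A'], whose size displays its tensor factors, to a matrix [A] of
    merely provably equal size. *)
Lemma sqmx_ind (P : forall n, 'M[R]_n -> Prop) m n (A : 'M_m) (A' : 'M_n) :
  sqmx A = sqmx A' -> P n A' -> P m A.
Proof.
move=> eqA; have e : m = n by exact: (congr1 tag eqA).
by case: n / e A' eqA => A' eqA; rewrite (eq_from_Tagged eqA).
Qed.

Lemma sqmx_ind2 (P : forall n, 'M[R]_n -> 'M[R]_n -> Prop) m n
    (A B : 'M_m) (A' B' : 'M_n) :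
  sqmx A = sqmx A' -> sqmx B = sqmx B' -> P n A' B' -> P m A B.
Proof.
move=> eqA; have e : m = n by exact: (congr1 tag eqA).
case: n / e A' B' eqA => A' B' eqA eqB.
by rewrite (eq_from_Tagged eqA) (eq_from_Tagged eqB).
Qed.

Definition sqtens (x y : {n : nat & 'M[R]_n}) : {n : nat & 'M[R]_n} :=
  sqmx (tagged x *t tagged y).

Lemma sqmx_tens m n (A : 'M[R]_m) (B : 'M[R]_n) :
  sqmx (A *t B) = sqtens (sqmx A) (sqmx B).
Proof. by []. Qed.

Lemma tensmxA m n p (A : 'M[R]_m) (B : 'M[R]_n) (C : 'M[R]_p) :
  castmx (mulnA m n p, mulnA m n p) (A *t (B *t C)) = A *t B *t C.
Proof.
apply/matrixP=> i j; rewrite castmxE !mxE mulrA.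
(* The three mixed-radix digits of an index are the same for both bracketings. *)
have dimE k := (etrans (congr1 (divn k) (mulnC n p)) (divnMA k p n),
  esym (modn_divl k n p), modn_dvdm k (dvdn_mull n (dvdnn p))).
by congr (A _ _ * B _ _ * C _ _); apply: val_inj; rewrite /= dimE.
Qed.

Lemma sqtensA : associative sqtens.
Proof.
move=> [m A] [n B] [p C]; rewrite /sqtens /= -tensmxA.
by rewrite sqmx_cast.
Qed.

Lemma tensmx11 m n : (1%:M : 'M[R]_m) *t (1%:M : 'M[R]_n) = 1%:M.
Proof.
apply/matrixP=> i j; case: (mxtens_indexP i) => i0 i1.
case: (mxtens_indexP j) => j0 j1; rewrite tensmxE !mxE -natrM mulnb.
by rewrite (can_eq (@mxtens_indexK m n)).
Qed.

Lemma sqtens11 m n :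
  sqtens (sqmx (1%:M : 'M_m)) (sqmx (1%:M : 'M_n)) = sqmx (1%:M : 'M_(m * n)).
Proof. by rewrite -sqmx_tens tensmx11. Qed.

Lemma sqtensx1 x : sqtens x (sqmx (1%:M : 'M_1)) = x.
Proof.
by case: x => n A; rewrite /sqtens /= tens_mx_scalar scale1r sqmx_cast.
Qed.

Lemma ntensmx_1 n k : ntensmx (1%:M : 'M[R]_n) k = 1%:M.
Proof.
case: k => // k; elim: k => [|k IHk] //=.
by rewrite ntensmxSS IHk tensmx11.
Qed.

Lemma tensmxBl m n p q (A B : 'M[R]_(m, n)) (C : 'M_(p, q)) :
  (A - B) *t C = A *t C - B *t C.
Proof. by apply/matrixP=> i j; rewrite !mxE mulrBl. Qed.

Lemma tensmxBr m n p q (C : 'M[R]_(m, n)) (A B : 'M_(p, q)) :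
  C *t (A - B) = C *t A - C *t B.
Proof. by apply/matrixP=> i j; rewrite !mxE mulrBr. Qed.

Lemma tensmxZl m n p q c (A : 'M[R]_(m, n)) (C : 'M_(p, q)) :
  (c *: A) *t C = c *: (A *t C).
Proof. by apply/matrixP=> i j; rewrite !mxE mulrA. Qed.

Lemma tensmxZr m n p q c (C : 'M[R]_(m, n)) (A : 'M_(p, q)) :
  C *t (c *: A) = c *: (C *t A).
Proof. by apply/matrixP=> i j; rewrite !mxE mulrCA. Qed.

End TensorCasts.

Lemma tensmx_eq0 (R : idomainType) m n p q (A : 'M[R]_(m, n)) (B : 'M_(p, q)) :
  A *t B = 0 -> B != 0 -> A = 0.
Proof.
move=> AB0 B_neq0; apply/matrixP=> i j; rewrite mxE; apply/eqP.
apply: contraNT B_neq0 => Aij; apply/eqP/matrixP=> k l; rewrite mxE.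
have := tensmxE A B i k j l; rewrite AB0 mxE => /esym/eqP.
by rewrite mulf_eq0 (negPf Aij) => /eqP.
Qed.

(** * The matrices tau(T_k) satisfy the Hecke relations *)

Section Legs.
Variables (K : fieldType) (n : nat) (T : 'M[K]_(n ^ 2)).

Local Notation "x ** y" := (sqtens x y) (at level 40, left associativity).
Local Notation U d := (sqmx (1%:M : 'M[K]_d)).

(* Zero when no k-th pair of legs exists, that is when [N < k.+2]. *)
Definition legs N k : 'M[K]_(n ^ N) :=
  oapp (legsN T) 0 (insub k : option 'I_N.-1).

Lemma sqmx_legs N k : (k.+2 <= N)%N ->
  sqmx (legs N k) = U (n ^ k) ** sqmx T ** U (n ^ (N - k.+2)).
Proof.
move=> kN; have kN' : (k < N.-1)%N by case: N kN.
by rewrite /legs insubT /= /legsN sqmx_cast !sqmx_tens !ntensmx_1.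
Qed.

Lemma sqmx_legs12 k r :
  sqmx ((1%:M : 'M[K]_k) *t legs12 T *t (1%:M : 'M[K]_r))
    = U k ** sqmx T ** U (n * r).
Proof. by rewrite /legs12 !sqmx_tens -sqtens11 !sqtensA. Qed.

Lemma sqmx_legs23 k r :
  sqmx ((1%:M : 'M[K]_k) *t legs23 T *t (1%:M : 'M[K]_r))
    = U (k * n) ** sqmx T ** U r.
Proof. by rewrite /legs23 !sqmx_tens sqmx_cast sqmx_tens -sqtens11 !sqtensA. Qed.

Lemma legs_family (a : nat -> K) N : T *m T = a 2 *: T ->
    legs12 T *m legs23 T *m legs12 T - legs23 T *m legs12 T *m legs23 T
      = legs12 T - legs23 T ->
  hecke_family a N.-1 (legs N).
Proof.
move=> quad braid.
have bound i : (i < N.-1)%N -> (i.+2 <= N)%N by case: N.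
split=> [i /bound iN|i /bound iN|i j ij /bound jN].
- apply: (sqmx_ind (P := fun d A => A *m A = a 2 *: A) (sqmx_legs iN)).
  by rewrite /= !tensmx_mul quad !mulmx1 tensmxZr tensmxZl.
- apply: (@sqmx_ind2 _
    (fun d A B => A *m B *m A - B *m A *m B = A - B) _ _ _ _
    ((1%:M : 'M_(n ^ i)) *t legs12 T *t (1%:M : 'M_(n ^ (N - i.+3))))
    (1%:M *t legs23 T *t 1%:M)).
  + by rewrite sqmx_legs ?sqmx_legs12 1?ltnW // -expnS subnSK.
  + by rewrite sqmx_legs ?sqmx_legs23 // -expnSr.
  + by rewrite !tensmx_mul !mulmx1 -!(tensmxBl, tensmxBr) braid.
(* Cut the legs into blocks of i, 2, j - i - 2, 2 and N - j - 2: the two copies of [T] occupy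
   different blocks. *)
- apply: (@sqmx_ind2 _ (fun d A B => A *m B = B *m A) _ _ _ _
    ((1%:M : 'M_(n ^ i)) *t T *t (1%:M : 'M_(n ^ (j - i.+2)))
      *t ((1%:M : 'M_(n ^ 2)) *t (1%:M : 'M_(n ^ (N - j.+2)))))
    ((1%:M : 'M_(n ^ i)) *t (1%:M : 'M_(n ^ 2)) *t (1%:M : 'M_(n ^ (j - i.+2)))
      *t (T *t (1%:M : 'M_(n ^ (N - j.+2)))))).
  + have eN : (N - i.+2 = j - i.+2 + (2 + (N - j.+2)))%N by lia.
    rewrite sqmx_legs; last by lia.
    by rewrite !sqmx_tens !sqtens11 -!sqtensA !sqtens11 -!expnD eN.
  + have ej : (i + 2 + (j - i.+2))%N = j by lia.
    by rewrite sqmx_legs // !sqmx_tens !sqtens11 sqtensA -!expnD ej.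
  + by rewrite !tensmx_mul !mulmx1 !mul1mx.
Qed.

End Legs.

(** * Adding two legs, and passing from the Hecke algebra to matrices *)

Section Embedding.
Variables (K : fieldType) (a : nat -> K).

Lemma asym_tens1 d m (t : nat -> 'M[K]_d) k :
  asym a (fun i => t i *t (1%:M : 'M_m)) k = asym a t k *t (1%:M : 'M_m).
Proof.
elim: k => [|k IHk] /=; first by rewrite tensmx11.
by rewrite IHk !tensmx_mul !mulmx1 tensmxBl tensmxZl.
Qed.

Lemma eq_asym d (t t' : nat -> 'M[K]_d) k :
  (forall i, (i < k)%N -> t i = t' i) -> asym a t k = asym a t' k.
Proof.
elim: k => //= k IHk eqt; rewrite eqt // IHk // => i ik.
by apply: eqt; apply: ltnW.
Qed.

Lemma sqmx_asym d d' (t : nat -> 'M[K]_d) (t' : nat -> 'M[K]_d') k :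
  d = d' -> (forall i, (i < k)%N -> sqmx (t i) = sqmx (t' i)) ->
  sqmx (asym a t k) = sqmx (asym a t' k).
Proof.
move=> e; case: d' / e t' => t' eqt; congr sqmx; apply: eq_asym => i ik.
exact: (eq_from_Tagged (eqt i ik)).
Qed.

(** The antisymmetrizer acts on the first [N.+1] of the [N.+3] legs and the other factor on the last
    two, so their product is a tensor product with [T], which can be cancelled. *)
Lemma asym_legs_eq0 n (T : 'M[K]_(n ^ 2)) N : T != 0 ->
    legs T N.+3 N.+1 *m asym a (legs T N.+3) N = 0 ->
  asym a (legs T N.+1) N = 0.
Proof.
move=> T_neq0 vanish; apply: (tensmx_eq0 _ T_neq0).
rewrite tensmx_decl -asym_tens1.
apply: (sqmx_ind2 (P := fun d A B => A *m B = 0) _ _ vanish).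
- by rewrite sqmx_legs // subnn expn0 sqtensx1.
- apply: sqmx_asym => [|i iN]; first by rewrite -expnD addn2.
  have iN1 : (i.+2 <= N.+1)%N by [].
  have iN3 : (i.+2 <= N.+3)%N by lia.
  have eN : (N.+1 - i.+2 + 2 = N.+3 - i.+2)%N by lia.
  rewrite sqmx_tens (sqmx_legs T iN1) (sqmx_legs T iN3).
  by rewrite -!sqtensA sqtens11 -expnD eN.
Qed.

End Embedding.

Lemma adjmx_legs (C : numClosedFieldType) n (T : 'M[C]_(n ^ 2)) N k :
  (k.+2 <= N)%N -> adjmx T = T -> adjmx (legs T N k) = legs T N k.
Proof.
move=> kN T_adj.
apply: (sqmx_ind (P := fun d A => adjmx A = A) (sqmx_legs T kN)) => /=.
have adj_tens m d (A : 'M[C]_m) (B : 'M[C]_d) :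
    adjmx (A *t B) = adjmx A *t adjmx B.
  by rewrite /adjmx trmx_tens map_mxT.
by rewrite !adj_tens T_adj !adjmx1.
Qed.

(** Both recursions agree, with indices shifted by one; [k < N] keeps each [insub] away from its
    default 0. *)
Lemma tau_qasym (K : fieldType) N (q : K) n (T : 'M[K]_(n ^ 2))
    (tau : hecke N q -> 'M[K]_(n ^ N)) k :
    linear tau -> monoid_morphism tau ->
    (forall k : 'I_N.-1, tau (heckeT q k) = legsN T k) -> (k < N)%N ->
  tau (qasym N q k.+1) = asym (fun j => qnum q j) (legs T N) k.
Proof.
move=> tau_lin [tau1 tauM] tauT.
have tauB x y : tau (x - y) = tau x - tau y.
  by rewrite addrC -scaleN1r tau_lin scaleN1r addrC.
have tau0 : tau 0 = 0 by rewrite -(subrr 0) tauB subrr.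
have tauZ c x : tau (c *: x) = c *: tau x.
  by rewrite -[_ *: x]addr0 tau_lin tau0 addr0.
elim: k => [|k IHk] kN; first exact: tau1.
have kN' : (k < N.-1)%N by lia.
rewrite [qasym _ _ _]/= -/(qasym N q k.+1) tauB tauZ !tauM IHk 1?ltnW //.
have -> // : tau (oapp (heckeT q) 0 (insub k)) = legs T N k.
by rewrite /legs insubT /= tauT.
Qed.

(** * Quantum integers as quotients of sines *)

Section QNumbers.
Variable R : realType.
Implicit Types x y : R.

Lemma expiD x y : expi (x + y) = expi x * expi y.
Proof. by rewrite /expi cosD sinD; simpc; congr Complex; rewrite addrC. Qed.

Lemma expi0 : expi (0 : R) = 1.
Proof. by rewrite /expi cos0 sin0. Qed.

Lemma expiV x : (expi x)^-1 = expi (- x).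
Proof.
have xNx : expi (- x) * expi x = 1 by rewrite -expiD addNr expi0.
have x_neq0 : expi x != 0.
  by apply: contra_eq_neq xNx => ->; rewrite mulr0 eq_sym oner_eq0.
by rewrite -[LHS]mul1r -xNx mulfK.
Qed.

Lemma expiMn x k : expi x ^+ k = expi (k%:R * x).
Proof.
elim: k => [|k IHk]; first by rewrite mul0r expi0.
by rewrite exprS IHk -expiD -natr1 mulrDl mul1r addrC.
Qed.

Lemma expiDV x : expi x + (expi x)^-1 = (cos x *+ 2)%:C%C.
Proof.
by apply/eqP; rewrite expiV eq_complex /= cosN sinN subrr mulr2n !eqxx.
Qed.

Lemma expiBV x : expi x - (expi x)^-1 = 'i%C * (sin x *+ 2)%:C%C.
Proof.
apply/eqP; rewrite expiV eq_complex /= cosN sinN opprK mulr2n.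
by rewrite !(mul0r, mulr0, mul1r, subrr, add0r, oppr0) !eqxx.
Qed.

(** The factors 2i cancel; if sin x = 0, both sides are 0 by the convention for division. *)
Lemma qnum_expi x (k : nat) :
  qnum (expi x) k = (sin (k%:R * x) / sin x)%:C%C.
Proof.
rewrite /qnum -exprnP -exprnN expiMn !expiBV -mulf_div divff ?mul1r; last first.
  by rewrite eq_complex /= oner_eq0 andbF.
rewrite -fmorph_div; congr (_%:C%C).
by rewrite -!(mulr_natr (sin _) 2) -mulf_div divff ?mulr1 // pnatr_eq0.
Qed.

End QNumbers.

Theorem proposition3 (R : realType) (N : nat) (hN : (2 <= N)%N) (gamma : R)
    (hgamma_lo : pi / N.+1%:R <= gamma) (hgamma_hi : gamma < pi / N%:R)
    (q : R[i]) (hq : q = expi gamma)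
    (n : nat) (hn : (1 <= n)%N) (T : 'M[R[i]]_(n ^ 2))
    (hherm : T \is hermsymmx) (hT0 : T != 0)
    (hTquad : T *m T = (q + q^-1) *: T)
    (hTbraid : legs12 T *m legs23 T *m legs12 T - legs23 T *m legs12 T *m legs23 T
               = legs12 T - legs23 T)
    (tau : hecke N q -> 'M[R[i]]_(n ^ N))
    (htau_lin : linear tau) (htau_mul : monoid_morphism tau)
    (htau : forall k : 'I_N.-1, tau (heckeT q k) = legsN T k) :
  tau (qasym N q N) = 0.
Proof.
pose a (k : nat) : R[i] := qnum q k.
pose s k := sin (k%:R * gamma) / sin gamma.
have aE k : a k = (s k)%:C%C by rewrite /a hq qnum_expi.
have N_gt0 : 0 < N%:R :> R by rewrite ltr0n; apply: ltnW.
have hlo : pi <= N.+1%:R * gamma by rewrite mulrC -ler_pdivrMr ?ltr0Sn.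
have hhi : N%:R * gamma < pi by rewrite mulrC -ltr_pdivlMr.
have gamma_gt0 : 0 < gamma.
  by apply: lt_le_trans hgamma_lo; rewrite divr_gt0 ?pi_gt0 ?ltr0Sn.
have sin_gt0 k : (0 < k <= N)%N -> 0 < sin (k%:R * gamma).
  case/andP=> k0 kN; apply: sin_gt0_pi; rewrite mulr_gt0 ?ltr0n //=.
  by apply: le_lt_trans hhi; rewrite ler_pM2r // ler_nat.
have sin1 : 0 < sin gamma by rewrite -[gamma]mul1r (sin_gt0 1%N) //= ltnW.
have s_gt0 k : (0 < k <= N)%N -> 0 < s k by move=> ?; rewrite divr_gt0 ?sin_gt0.
(* (N+1) gamma lies in [pi, 2 pi], since N gamma < pi and gamma <= N gamma. *)
have sN1_le0 : s N.+1 <= 0.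
  rewrite /s pmulr_lle0 ?invr_gt0 // -[_ * gamma](subrK pi) sinDpi oppr_le0.
  apply: sin_ge0_pi; rewrite subr_ge0 hlo /= lerBlDr -natr1 mulrDl mul1r.
  apply: lerD; first exact: ltW.
  apply: le_trans (ltW hhi); rewrite -[leLHS]mul1r ler_pM2r // ler1n.
  exact: ltnW.
have a1 : a 1 = 1 by rewrite aE /s mul1r divff // gt_eqF.
have a2 : a 2 = q + q^-1.
  rewrite aE hq expiDV; congr (_%:C%C).
  rewrite /s mulr_natl mulr2n sinD [cos _ * _]mulrC -mulr2n -mulrnAr mulrAC.
  by rewrite mulfV ?gt_eqF // mul1r.
have a_rec k : a k.+2 = a 2 * a k.+1 - a k.
  rewrite a2 hq expiDV !aE -rmorphM -rmorphB; congr (_%:C%C) => /=.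
  rewrite /s mulrA -mulrBl; congr (_ / _).
  have -> : k.+2%:R * gamma = k.+1%:R * gamma + gamma.
    by rewrite -natr1 mulrDl mul1r.
  have -> : k%:R * gamma = k.+1%:R * gamma - gamma.
    by rewrite -natr1 mulrDl mul1r addrK.
  by rewrite sinD sinB; ring.
have a_real j : Num.conj (a j) = a j by rewrite aE; exact: conjc_real.
have T_adj : adjmx T = T.
  by have /is_hermitianmxP/esym := hherm; rewrite scale1r.
have eN : N.-1.+1 = N by rewrite prednK // ltnW.
(* The vanishing lemma is applied with [m = N.-1] on N + 2 legs; its sign conditions are [2] > 0,
   from N >= 2, and [N+1]/[N] <= 0. *)
have vanish : asym a (legs T N.-1.+1) N.-1 = 0.
  apply: (asym_legs_eq0 hT0); apply: last_mul_asym_eq0 => //.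
  - by apply: legs_family; rewrite // a2.
  - by move=> i iN; apply: adjmx_legs.
  - move=> j; rewrite eN => /s_gt0 sj.
    by rewrite aE fmorph_eq0 gt_eqF.
  - by rewrite aE ltcR s_gt0.
  - rewrite eN !aE -fmorph_div -[0](rmorph0 (real_complex R)) lecR.
    by rewrite mulr_le0_ge0 // invr_ge0 ltW // s_gt0 // leqnn andbT ltnW.
have := @tau_qasym _ _ _ _ _ tau N.-1 htau_lin htau_mul htau.
rewrite eN in vanish *.
by move=> ->.
Qed.
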